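(* Let $a>0$. For every integer $r\ge 0$, every integer $p\ge 0$, every real $x$ with $|x|<a$, and every $z\in\mathbb{C}$ with $|z|\le 1$, $z\ne 1$, we have $$\sum_{n=0}^{\infty}\binom{n+r}{n}n^{p}\,\Phi(n+r+1,z,a)\,x^{n}=\frac{1}{r!}\sum_{j=0}^{p}S(p,j)\,\Gamma(j+r+1)\,x^{j}\,\Phi(r+j+1,z,a-x).$$
   Context: $S(p,j)$ denotes the Stirling numbers of the second kind, with $S(0,0)=1$. The Lerch Transcendent (with this order of arguments) is $\Phi(s,z,a)=\sum_{n=0}^{\infty}\frac{z^{n}}{(n+a)^{s}}$ for $a>0$, $|z|\le1$, $z\ne1$. Conventions: $0^0=1$. *)

(* Defs.v *)
From mathcomp Require Import all_boot.
From Stdlib Require Import Reals.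
From Coquelicot Require Import Coquelicot.

(* Number of partitions of a p-element set into j nonempty blocks; the empty
   set has exactly one partition, the one with no blocks, so S(0,0) = 1. *)
Definition stirling2 (p j : nat) : nat :=
  #|[set P : {set {set 'I_p}} | partition P [set: 'I_p] & #|P| == j]|.

Local Open Scope R_scope.

(* Euler's integral, improper at both endpoints; meaningful for 0 < s. *)
Definition Gamma (s : R) : R :=
  RInt_gen (fun t : R => Rpower t (s - 1) * exp (- t))
    (at_right 0) (Rbar_locally p_infty).

(* Sum of a complex series as the limit of its partial sums, which need not
   converge absolutely; unspecified when the series diverges. *)
Definition CSeries (u : nat -> C) : C :=
  @iota C_CompleteNormedModule (@is_series C_AbsRing C_NormedModule u).

(* The order s comes first.  [Rpower] is the usual real power, since n + a is
   positive for a > 0.  At s = 1 and |z| = 1, z <> 1, the series converges only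
   conditionally. *)
Definition LerchPhi (s : R) (z : C) (a : R) : C :=
  CSeries (fun n : nat => (z ^ n / RtoC (Rpower (INR n + a) s))%C).

(* Main.v *)
Require Import Defs.
From Stdlib Require Import Arith Reals Lra Lia.
From mathcomp Require all_boot.
From Coquelicot Require Import Coquelicot.

(** Expand each value of the Lerch transcendent on the left as a series over
    [m].  For fixed [m], put [b = m + a]; then the identity reduces to the
    closed form of the real power series
    [sum_n C(n+r,n) n^p x^n / b^(n+r+1)], valid because [|x| < a <= b].  That
    closed form ([is_series_stirling]) comes from writing [n^p] in falling
    factorials ([pow_stirling2]): the falling factorial of order [j] turns the
    negative binomial series of exponent [r+1] into the one of exponent
    [r+j+1], up to the factor [(j+r)!/r! y^j].  Multiplying by [z^m], summing
    over [m] and using [Gamma (j+r+1) = (j+r)!] gives the right-hand side.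

    What has to be justified is summing over [m] before [n].  For [r = 0] and
    [|z| = 1] the row [n = 0] converges only conditionally, so the double
    series is not absolutely summable and neither Fubini nor Tonelli applies.
    But every row [n > 0] carries at least two powers of [1 / (m+a)], so it is
    dominated by [e n * w m] with [w m = a^2 / (m+a)^2] summable and
    [e n = C(n+r,n) n^p |x|^n / a^(n+r+1)], again a negative binomial series.
    Finitely many rows may always be summed together, and the remaining rows
    contribute at most the tail of [e] times the sum of [w]: this is
    [series_exchange].

    Convergence of all the Lerch series involved, conditional or not, follows
    from Abel summation ([ex_series_Abel]), which needs only [|z| <= 1] and
    [z <> 1].

    The expansion of [n^p] is a count of the functions from a [p]-element set
    to an [n]-element set by the partition into fibres: those with a given
    partition are the injections of its blocks. *)

(** * Powers in terms of falling factorials *)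

Module StirlingNumbers.
Import all_boot.
Local Open Scope nat_scope.

Section KernelPartition.
Variables p n : nat.
Implicit Types (P : {set {set 'I_p}}) (f : {ffun 'I_p -> 'I_n}).

(** Such a function is constant on the blocks of [P] and separates them, so it
    factors through an injection from the blocks, and every injection arises
    from exactly one function because no block is empty. *)
Lemma card_ffun_with_kernel P :
  partition P [set: 'I_p] ->
  #|[set f : {ffun 'I_p -> 'I_n} | preim_partition f [set: 'I_p] == P]| = n ^_ #|P|.
Proof.
move=> partP; have [/eqP covP tiP nP0] := and3P partP.
have inP x : pblock P x \in P by rewrite pblock_mem // covP inE.
pose blk x : {B | B \in P} := exist _ (pblock P x) (inP x).
pose glue (g : {ffun {B | B \in P} -> 'I_n}) := [ffun x => g (blk x)].
have blk_surj (B : {B | B \in P}) : exists x, blk x == B.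
  case: B => B PB; have /set0Pn[x Bx]: B != set0 by apply: contraNneq nP0 => <-.
  by exists x; rewrite -val_eqE /= (def_pblock tiP PB).
have glue_inj : injective glue.
  move=> g h /ffunP eq_gh; apply/ffunP=> B; have [x /eqP<-] := blk_surj B.
  by have := eq_gh x; rewrite !ffunE.
have -> : [set f : {ffun 'I_p -> 'I_n} | preim_partition f [set: 'I_p] == P]
  = glue @: [set g : {ffun {B | B \in P} -> 'I_n} | injectiveb g].
  apply/setP=> f; rewrite inE; apply/eqP/imsetP=> [kerf | [g]].
    have same x y : (f x == f y) = (pblock P x == pblock P y).
      rewrite eq_pblock ?covP ?inE // -kerf.
      rewrite pblock_equivalence_partition ?inE //.
      by split=> // /eqP->.
    pose g := [ffun B : {B | B \in P} => f (xchoose (blk_surj B))].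
    have gE x : g (blk x) = f x.
      rewrite ffunE; apply/eqP; rewrite same; apply/eqP.
      exact: (congr1 val (eqP (xchooseP (blk_surj (blk x))) : _ = blk x)).
    exists g; last by apply/ffunP=> x; rewrite ffunE gE.
    rewrite inE; apply/injectiveP=> B1 B2.
    have [x1 /eqP<-] := blk_surj B1; have [x2 /eqP<-] := blk_surj B2.
    rewrite !gE => /eqP; rewrite same => /eqP eqB.
    exact: val_inj.
  rewrite inE => /injectiveP g_inj ->.
  rewrite -[RHS](preim_partition_pblock partP).
  apply: eq_imset => x; apply/setP=> y; rewrite !inE !ffunE.
  by rewrite (inj_eq g_inj).
by rewrite card_imset // card_inj_ffuns card_ord card_sig.
Qed.

End KernelPartition.

Lemma card_blocks_le p (P : {set {set 'I_p}}) :
  partition P [set: 'I_p] -> #|P| <= p.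
Proof.
move=> partP; have [_ _ nP0] := and3P partP.
rewrite -[X in _ <= X]card_ord -cardsT (card_partition partP) -sum1_card.
apply: leq_sum => B PB; rewrite card_gt0.
by apply: contraNneq nP0 => <-.
Qed.

(** Both sides count the functions from ['I_p] to ['I_n]; on the right they are
    sorted by the number of nonempty fibres. *)
Lemma expn_stirling2 n p : n ^ p = \sum_(j < p.+1) stirling2 p j * n ^_ j.
Proof.
pose ker (f : {ffun 'I_p -> 'I_n}) := preim_partition f [set: 'I_p].
have -> : n ^ p = \sum_(P | partition P [set: 'I_p]) n ^_ #|P|.
  rewrite -[in LHS](card_ord n) -[in LHS](card_ord p) -card_ffun -sum1_card.
  rewrite (partition_big ker (fun P => partition P [set: 'I_p])) /=;
    last by move=> f _; apply: preim_partitionP.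
  apply: eq_bigr => P partP; rewrite -(@card_ffun_with_kernel p n P partP) -sum1_card.
  by apply: eq_bigl => f; rewrite inE.
rewrite (partition_big (fun P : {set {set 'I_p}} => inord #|P| : 'I_p.+1) xpredT) //=.
apply: eq_bigr => j _; rewrite /stirling2 -[X in _ = X * _]sum1_card big_distrl /=.
apply: congr_big => // [P | P /andP[partP /eqP <-]].
  rewrite inE; apply: andb_id2l => partP.
  by rewrite -val_eqE /= inordK // ltnS card_blocks_le.
by rewrite mul1n inordK // ltnS card_blocks_le.
Qed.

Lemma factorialE n : factorial n = fact n.
Proof. by elim: n => // n IHn; rewrite factS IHn. Qed.

Lemma ffact_lt n j : (n < j)%coq_nat -> falling_factorial n j = 0.
Proof. by move/ltP; apply: ffact_small. Qed.

(** Stated with the sum and product of [Init.Nat], which [rewrite] distinguishes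
    from those of [ssrnat]. *)
Lemma ffact_shift k j :
  Nat.mul (falling_factorial (Nat.add k j) j) (fact k) = fact (Nat.add k j).
Proof. by rewrite -!factorialE plusE -(ffact_fact (leq_addl k j)) addnK. Qed.

Local Open Scope R_scope.

Lemma pow_stirling2 n p :
  INR n ^ p =
  sum_n (fun j => INR (stirling2 p j) * INR (falling_factorial n j)) p.
Proof.
have sumE (F : nat -> nat) m :
    INR (\sum_(j < m.+1) F j)%N = sum_n (fun j => INR (F j)) m.
  elim: m => [|m IHm]; first by rewrite big_ord1 sum_O.
  by rewrite big_ord_recr sum_Sn /= plus_INR IHm.
have -> : INR n ^ p = INR (n ^ p)%N.
  by elim: p => // m IHm; rewrite expnS mult_INR -IHm.
rewrite expn_stirling2 (sumE (fun j => stirling2 p j * n ^_ j)%N).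
by apply: sum_n_ext => j; rewrite mult_INR.
Qed.

End StirlingNumbers.

Import StirlingNumbers.

Local Open Scope R_scope.

Local Notation is_Cseries := (@is_series C_AbsRing C_NormedModule).
Local Notation Csum_n := (@sum_n C_AbelianMonoid).

(* Equations between series live in the carrier of a normed module, where
   [ring] and [field] do not recognise the field of scalars. *)
Ltac eq_at T := match goal with |- @eq _ ?s ?t => change (@eq T s t) end.

(** * Abel summation *)

Lemma is_series_telescope (v : nat -> R) :
  is_lim_seq v 0 -> is_series (fun m => v m - v (S m)) (v 0%nat).
Proof.
  intros Hv.
  assert (E : forall n, sum_n (fun m => v m - v (S m)) n = v 0%nat - v (S n)).
  { induction n as [|n IH]; [now rewrite sum_O|].
    rewrite sum_Sn, IH; unfold plus; simpl; ring. }
  assert (L : is_lim_seq (sum_n (fun m => v m - v (S m))) (v 0%nat)).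
  2: exact L.
  apply is_lim_seq_ext with (fun n => v 0%nat - v (S n)).
  { intros n; now rewrite E. }
  replace (Finite (v 0%nat)) with (Finite (v 0%nat - 0)) by (f_equal; ring).
  apply is_lim_seq_minus'; [apply is_lim_seq_const|].
  now apply is_lim_seq_incr_1 in Hv.
Qed.

Lemma pow_le_1 (q : R) n : 0 <= q <= 1 -> q ^ n <= 1.
Proof. intros H; rewrite <- (pow1 n); now apply pow_incr. Qed.

(** Multiplying the partial sums by [1 - z] (nonzero) and summing by parts
    leaves, besides terms tending to [0], the series of
    [z^(m+1) * (v m - v (m+1))], which is dominated by a telescoping series. *)
Lemma ex_series_Abel (v : nat -> R) (z : C) :
  (forall n, v (S n) <= v n) -> is_lim_seq v 0 -> Cmod z <= 1 -> z <> RtoC 1 ->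
  exists l, is_Cseries (fun m => z ^ m * RtoC (v m))%C l.
Proof.
  intros Hdec Hlim Hz Hz1.
  assert (Hz1' : (1 - z)%C <> 0).
  { intros H; apply Hz1; replace z with (1 - (1 - z))%C by ring; rewrite H; ring. }
  assert (Hpow : forall n, Cmod (z ^ n) <= 1).
  { intros n; rewrite Cmod_pow; apply pow_le_1; split; [apply Cmod_ge_0|exact Hz]. }
  set (d := fun m => (z ^ S m * RtoC (v m - v (S m)))%C).
  set (e := fun m => (z ^ S m * RtoC (v (S m)))%C).
  assert (Ed : exists D, is_Cseries d D).
  { apply (@ex_series_le C_AbsRing C_CompleteNormedModule d (fun m => v m - v (S m))).
    - intros n; change (norm (d n)) with (Cmod (d n)); unfold d.
      rewrite Cmod_mult, Cmod_R, Rabs_pos_eq by (specialize (Hdec n); lra).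
      rewrite <- (Rmult_1_l (v n - v (S n))) at 2.
      apply Rmult_le_compat_r; [specialize (Hdec n); lra|apply Hpow].
    - eexists; now apply is_series_telescope. }
  destruct Ed as [D HD].
  assert (He : filterlim e eventually (@locally C_NormedModule (RtoC 0))).
  { apply (@filterlim_norm_zero nat C_AbsRing C_NormedModule eventually _ e).
    assert (L : is_lim_seq (fun n => Cmod (e n)) 0).
    2: exact L.
    apply is_lim_seq_le_le with (fun _ => 0) (fun n => Rabs (v (S n))).
    - intros n; split; [apply Cmod_ge_0|]; unfold e; rewrite Cmod_mult, Cmod_R.
      rewrite <- (Rmult_1_l (Rabs (v (S n)))) at 2.
      apply Rmult_le_compat_r; [apply Rabs_pos|apply Hpow].
    - apply is_lim_seq_const.
    - replace (Finite 0) with (Rbar_abs 0) by (simpl; now rewrite Rabs_R0).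
      now apply is_lim_seq_abs, is_lim_seq_incr_1 in Hlim. }
  assert (E : forall n, Csum_n (fun m => z ^ m * RtoC (v m))%C n =
      (/ (1 - z) * (RtoC (v 0%nat) + - (Csum_n d n + e n)))%C).
  { intros n.
    assert (E : ((1 - z) * Csum_n (fun m => z ^ m * RtoC (v m)) n
       = RtoC (v 0%nat) + - (Csum_n d n + e n))%C).
    { induction n as [|n IH].
      - rewrite !sum_O; unfold d, e; rewrite RtoC_minus; simpl; ring.
      - rewrite !sum_Sn; change plus with Cplus.
        rewrite Cmult_plus_distr_l, IH; unfold d, e; rewrite RtoC_minus; simpl; ring. }
    rewrite <- E, Cmult_assoc, Cinv_l by exact Hz1'; now rewrite Cmult_1_l. }
  exists (/ (1 - z) * (RtoC (v 0%nat) + - (D + RtoC 0)))%C.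
  unfold is_series.
  apply filterlim_ext with
    (fun n => (/ (1 - z) * (RtoC (v 0%nat) + - (Csum_n d n + e n)))%C).
  { intros n; symmetry; apply E. }
  refine (filterlim_comp _ _ _ _ (fun w : C => (/ (1 - z) * w)%C) _ _ _ _
     (@filterlim_scal_r C_AbsRing C_NormedModule (/ (1 - z))%C _)).
  eapply filterlim_comp_2.
  { apply filterlim_const. }
  2: apply (@filterlim_plus C_AbsRing C_NormedModule).
  refine (filterlim_comp _ _ _ (fun n => (Csum_n d n + e n)%C) Copp _ _ _ _
    (@filterlim_opp C_AbsRing C_NormedModule _)).
  eapply filterlim_comp_2.
  { exact HD. }
  { exact He. }
  apply (@filterlim_plus C_AbsRing C_NormedModule).
Qed.

(** * The gamma function at positive integers *)

(** One term of the exponential series beyond [t^n] gives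
    [t^n / exp t <= (n+1)! / t]. *)
Lemma is_lim_pow_exp n : is_lim (fun t => t ^ n * exp (- t)) p_infty 0.
Proof.
  apply is_lim_le_le_loc with (fun _ => 0) (fun t => INR (fact (S n)) * / t).
  - exists 0; intros t Ht; split.
    + apply Rmult_le_pos; [apply pow_le; lra|left; apply exp_pos].
    + assert (T : t ^ S n / INR (fact (S n)) <= exp t).
      { apply Rle_trans with (2 := exp_ge_taylor t (S n) (Rlt_le _ _ Ht)).
        rewrite tech5.
        assert (0 <= sum_f_R0 (fun k => t ^ k / INR (fact k)) n); [|lra].
        apply cond_pos_sum; intros k; apply Rmult_le_pos; [apply pow_le; lra|].
        left; apply Rinv_0_lt_compat, INR_fact_lt_0. }
      pose proof (INR_fact_lt_0 (S n)) as F; pose proof (exp_pos t) as E.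
      rewrite exp_Ropp; apply Rmult_le_reg_r with (exp t * t); [nra|].
      apply Rmult_le_compat_r with (r := INR (fact (S n))) in T; [|lra].
      unfold Rdiv in T; rewrite Rmult_assoc, Rinv_l, Rmult_1_r in T by lra.
      replace (t ^ n * / exp t * (exp t * t)) with (t ^ S n) by (simpl; field; lra).
      replace (INR (fact (S n)) * / t * (exp t * t)) with (exp t * INR (fact (S n)))
        by (field; lra).
      exact T.
  - apply is_lim_const.
  - replace (Finite 0) with (Rbar_mult (INR (fact (S n))) 0) by (simpl; f_equal; ring).
    apply is_lim_scal_l.
    replace (Finite 0) with (Rbar_inv p_infty) by reflexivity.
    apply is_lim_inv; [apply is_lim_id|easy].
Qed.

(** Antiderivative of [t^n * exp (- t)] vanishing at infinity, that is, minus
    the upper incomplete gamma function of order [n + 1]; the recursion is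
    integration by parts. *)
Fixpoint gamma_prim (n : nat) (t : R) : R :=
  match n with
  | O => - exp (- t)
  | S m => INR n * gamma_prim m t - t ^ n * exp (- t)
  end.

Lemma is_derive_gamma_prim n t :
  is_derive (gamma_prim n) t (t ^ n * exp (- t)).
Proof.
  induction n as [|n IH].
  - simpl; auto_derive; [easy|ring].
  - replace (t ^ S n * exp (- t)) with
     (INR (S n) * (t ^ n * exp (- t))
      - (INR (S n) * t ^ n * exp (- t) - t ^ S n * exp (- t))) by ring.
    change (gamma_prim (S n)) with
      (fun t => INR (S n) * gamma_prim n t - t ^ S n * exp (- t)).
    apply (@is_derive_minus R_AbsRing R_NormedModule
      (fun t => INR (S n) * gamma_prim n t) (fun t => t ^ S n * exp (- t))).
    + now apply (is_derive_scal (gamma_prim n)).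
    + auto_derive; [easy|]. rewrite S_INR; simpl; destruct n; simpl; ring.
Qed.

Lemma gamma_prim_0 n : gamma_prim n 0 = - INR (fact n).
Proof.
  induction n as [|n IH].
  - simpl; rewrite Ropp_0, exp_0; ring.
  - change (gamma_prim (S n) 0) with
      (INR (S n) * gamma_prim n 0 - 0 ^ S n * exp (- 0)).
    rewrite IH, fact_simpl, mult_INR; simpl; ring.
Qed.

Lemma is_lim_gamma_prim n : is_lim (gamma_prim n) p_infty 0.
Proof.
  induction n as [|n IH].
  - apply is_lim_ext with (fun t => - (t ^ 0 * exp (- t))); [intros; simpl; ring|].
    replace (Finite 0) with (Rbar_opp 0) by (simpl; f_equal; ring).
    apply is_lim_opp, is_lim_pow_exp.
  - replace (Finite 0) with (Finite (INR (S n) * 0 - 0)) by (f_equal; ring).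
    apply (is_lim_minus' (fun t => INR (S n) * gamma_prim n t) (fun t => t ^ S n * exp (- t))).
    + now apply (is_lim_scal_l (gamma_prim n) (INR (S n)) p_infty 0).
    + apply is_lim_pow_exp.
Qed.

Lemma Gamma_fact n : Gamma (INR (n + 1)) = INR (fact n).
Proof.
  unfold Gamma.
  apply (@is_RInt_gen_unique R_CompleteNormedModule); try typeclasses eauto.
  assert (Dg : forall t, Derive (gamma_prim n) t = t ^ n * exp (- t)).
  { intros t; apply is_derive_unique, is_derive_gamma_prim. }
  assert (I : is_RInt_gen (Derive (gamma_prim n)) (at_right 0) (Rbar_locally p_infty)
    (0 - - INR (fact n))).
  { apply is_RInt_gen_Derive.
    - apply filter_forall; intros ab t _; eexists; apply is_derive_gamma_prim.
    - apply filter_forall; intros ab t _.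
      apply continuous_ext with (fun t => t ^ n * exp (- t));
        [intros; now rewrite Dg|].
      apply (@ex_derive_continuous R_AbsRing R_NormedModule); auto_derive; easy.
    - rewrite <- gamma_prim_0.
      eapply filterlim_filter_le_1; [apply filter_le_within|].
      apply (@ex_derive_continuous R_AbsRing R_NormedModule).
      eexists; apply is_derive_gamma_prim.
    - apply is_lim_gamma_prim. }
  replace (0 - - INR (fact n)) with (INR (fact n)) in I by ring.
  revert I; apply (@is_RInt_gen_ext R_NormedModule); try typeclasses eauto.
  apply (Filter_prod _ _ _ (fun a => 0 < a) (fun b => 0 < b)).
  - exists (mkposreal 1 Rlt_0_1); now intros.
  - exists 0; now intros.
  - intros a b Ha Hb t [Ht _]; simpl in Ht.
    rewrite Dg; f_equal.
    assert (0 < t) by (revert Ht; unfold Rmin; destruct (Rle_dec a b); lra).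
    replace (INR (n + 1) - 1) with (INR n) by (rewrite plus_INR; simpl; ring).
    now rewrite Rpower_pow.
Qed.

(** * Finite sums and exchange of summations *)

Lemma is_series_sum_n {K : AbsRing} {V : NormedModule K} (a : nat -> nat -> V)
    (A : nat -> V) p :
  (forall j, is_series (a j) (A j)) ->
  is_series (fun n => sum_n (fun j => a j n) p) (sum_n A p).
Proof.
  intros HA; induction p as [|p IH].
  - rewrite sum_O; apply is_series_ext with (a 0%nat); [|apply HA].
    intros n; now rewrite sum_O.
  - rewrite sum_Sn.
    apply is_series_ext with (fun n => plus (sum_n (fun j => a j n) p) (a (S p) n)).
    { intros n; now rewrite sum_Sn. }
    now apply is_series_plus.
Qed.

Lemma RtoC_sum_n (a : nat -> R) n : RtoC (sum_n a n) = Csum_n (fun k => RtoC (a k)) n.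
Proof.
  induction n as [|n IH]; [now rewrite !sum_O|].
  rewrite !sum_Sn, <- IH; apply RtoC_plus.
Qed.

Lemma is_series_RtoC (a : nat -> R) l :
  is_series a l -> is_Cseries (fun n => RtoC (a n)) (RtoC l).
Proof.
  intros Ha; unfold is_series.
  apply filterlim_ext with (fun n => RtoC (sum_n a n)).
  { intros n; apply RtoC_sum_n. }
  refine (filterlim_comp _ _ _ (sum_n a) RtoC _ _ _ Ha _).
  intros P [eps HP]; exists eps; intros y Hy; apply HP.
  split; [exact Hy|apply ball_center].
Qed.

(** Bounding only the terms beyond [N] is what makes the lemma usable on series
    whose first terms are not dominated. *)
Lemma Cmod_series_tail_le (u : nat -> C) (v : nat -> R) U V N :
  is_Cseries u U -> is_series v V ->
  (forall n, (N < n)%nat -> Cmod (u n) <= v n) ->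
  Cmod (U - Csum_n u N) <= V - sum_n v N.
Proof.
  intros HU HV Huv.
  assert (LU : is_lim_seq (fun M => Cmod (Csum_n u M - Csum_n u N)) (Cmod (U - Csum_n u N))).
  { refine (filterlim_comp _ _ _ (fun M => (Csum_n u M - Csum_n u N)%C) Cmod _
      (@locally C_NormedModule (U - Csum_n u N)%C) _ _
      (@filterlim_norm C_AbsRing C_NormedModule _)).
    unfold Cminus; eapply filterlim_comp_2; [exact HU|apply filterlim_const|].
    apply (@filterlim_plus C_AbsRing C_NormedModule). }
  assert (LV : is_lim_seq (fun M => sum_n v M - sum_n v N) (V - sum_n v N)).
  { apply is_lim_seq_minus'; [exact HV|apply is_lim_seq_const]. }
  refine (is_lim_seq_le_loc _ _ (Finite _) (Finite _) _ LU LV).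
  exists N; intros M HM.
  induction HM as [|M HM IH].
  - unfold Cminus; rewrite Cplus_opp_r, Cmod_0; lra.
  - rewrite !sum_Sn.
    replace (plus (Csum_n u M) (u (S M)) - Csum_n u N)%C
      with (Csum_n u M - Csum_n u N + u (S M))%C
      by (change plus with Cplus; ring).
    eapply Rle_trans; [apply Cmod_triangle|].
    change (plus (sum_n v M) (v (S M))) with (sum_n v M + v (S M)).
    assert (Cmod (u (S M)) <= v (S M)) by (apply Huv; lia); lra.
Qed.

Lemma Cmod_series_le (u : nat -> C) (v : nat -> R) U V :
  is_Cseries u U -> is_series v V -> (forall n, Cmod (u n) <= v n) -> Cmod U <= V.
Proof.
  intros HU HV Huv.
  pose proof (Cmod_series_tail_le u v U V 0 HU HV (fun n _ => Huv n)) as H.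
  rewrite !sum_O in H; specialize (Huv 0%nat).
  replace U with ((U - u 0%nat) + u 0%nat)%C by ring.
  eapply Rle_trans; [apply Cmod_triangle|lra].
Qed.

(** Exchange of two summations without domination of the row [n = 0], which may
    converge conditionally.  The remainder [T - sum_(n <= N) U n] is the sum over
    [m] of the column remainders, each at most [w m] times the tail of [e]
    beyond [N]; hence it is at most that tail times the sum of [w]. *)
Lemma series_exchange (u : nat -> nat -> C) (e w : nat -> R) (U F : nat -> C) T :
  ex_series e -> ex_series w ->
  (forall n m, (0 < n)%nat -> Cmod (u n m) <= e n * w m) ->
  (forall n, is_Cseries (u n) (U n)) ->
  (forall m, is_Cseries (fun n => u n m) (F m)) ->
  is_Cseries F T -> is_Cseries U T.
Proof.
  intros [E HE] [W HW] Hu HU HF HT.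
  assert (B : forall N, Cmod (Csum_n U N - T) <= (E - sum_n e N) * W).
  { intros N.
    replace (Csum_n U N - T)%C with (- (T - Csum_n U N))%C by ring.
    rewrite Cmod_opp.
    apply Cmod_series_le with
      (fun m => F m - Csum_n (fun n => u n m) N)%C
      (fun m => (E - sum_n e N) * w m).
    - apply (@is_series_minus C_AbsRing C_NormedModule); [exact HT|].
      now apply (@is_series_sum_n C_AbsRing C_NormedModule).
    - now apply (@is_series_scal_l R_AbsRing R_NormedModule).
    - intros m.
      rewrite Rmult_minus_distr_r.
      replace (sum_n e N * w m) with (sum_n (fun n => e n * w m) N)
        by apply (sum_n_mult_r (K := R_Ring)).
      apply Cmod_series_tail_le; [apply HF| |].
      + now apply is_series_scal_r.
      + intros n Hn; apply Hu; lia. }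
  assert (L : is_lim_seq (fun N => (E - sum_n e N) * W) 0).
  { replace (Finite 0) with (Finite ((E - E) * W)) by (f_equal; ring).
    apply is_lim_seq_mult'; [|apply is_lim_seq_const].
    apply is_lim_seq_minus'; [apply is_lim_seq_const|exact HE]. }
  apply is_lim_seq_spec in L.
  apply (@filterlim_locally_ball_norm C_AbsRing nat C_NormedModule eventually _).
  intros eps; destruct (L eps) as [N0 HN0].
  exists N0; intros N HN; specialize (HN0 N HN).
  change (Cmod (Csum_n U N - T) < eps).
  eapply Rle_lt_trans; [apply B|].
  rewrite Rminus_0_r in HN0; eapply Rle_lt_trans; [apply Rle_abs|exact HN0].
Qed.

(** * Negative binomial series *)

Lemma sum_binomial_diagonal s n :
  sum_f_R0 (fun k => Binomial.C (k + s) k) n = Binomial.C (n + S s) n.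
Proof.
  induction n as [|n IH].
  - simpl; now rewrite !C_n_0.
  - rewrite tech5, IH.
    replace (S n + s)%nat with (n + S s)%nat by lia.
    rewrite pascal by lia; reflexivity.
Qed.

(** Raising the exponent by one is taking the Cauchy product with the geometric
    series, whose coefficients are the diagonal sums of binomials. *)
Lemma is_series_negative_binomial s y : Rabs y < 1 ->
  is_series (fun k => Binomial.C (k + s) k * y ^ k) (/ (1 - y) ^ S s).
Proof.
  revert y; induction s as [|s IH]; intros y Hy.
  - apply is_series_ext with (fun k => y ^ k).
    { intros k; rewrite Nat.add_0_r, C_n_n; symmetry; apply Rmult_1_l. }
    rewrite pow_1; now apply is_series_geom.
  - assert (Hy' : Rabs (Rabs y) < 1) by now rewrite Rabs_Rabsolu.
    replace (/ (1 - y) ^ S (S s)) with (/ (1 - y) ^ S s * / (1 - y))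
      by (rewrite <- Rinv_mult; f_equal; simpl; ring).
    apply is_series_ext with
      (fun n => sum_f_R0 (fun k => Binomial.C (k + s) k * y ^ k * y ^ (n - k)) n).
    { intros n; rewrite <- sum_binomial_diagonal, Rmult_comm, scal_sum.
      apply sum_eq; intros k Hk.
      rewrite Rmult_assoc, <- pow_add; do 2 f_equal; lia. }
    apply (is_series_mult (fun k => Binomial.C (k + s) k * y ^ k) (fun k => y ^ k)).
    + now apply IH.
    + now apply is_series_geom.
    + exists (/ (1 - Rabs y) ^ S s).
      apply is_series_ext with (fun k => Binomial.C (k + s) k * Rabs y ^ k);
        [|now apply IH].
      intros k; rewrite Rabs_mult, <- RPow_abs; f_equal; symmetry.
      apply Rabs_pos_eq; unfold Binomial.C.
      apply Rmult_le_pos; [apply pos_INR|].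
      left; apply Rinv_0_lt_compat, Rmult_lt_0_compat; apply INR_fact_lt_0.
    + exists (/ (1 - Rabs y)).
      apply is_series_ext with (fun k => Rabs y ^ k); [|now apply is_series_geom].
      intros k; apply RPow_abs.
Qed.

(** The terms [n < j] vanish; with [n = k + j], the factor [n!/k!] merges with
    [C(n+r,n) = (n+r)!/(n! r!)] into [(j+r)!/r! * C(k+r+j,k)]. *)
Lemma is_series_negative_binomial_falling r j y : Rabs y < 1 ->
  is_series (fun n => Binomial.C (n + r) n * INR (binomial.falling_factorial n j) * y ^ n)
    (INR (fact (j + r)) / INR (fact r) * y ^ j * / (1 - y) ^ S (r + j)).
Proof.
  intros Hy.
  assert (S0 : is_series (fun k => Binomial.C (k + j + r) (k + j)
      * INR (binomial.falling_factorial (k + j) j) * y ^ (k + j))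
    (INR (fact (j + r)) / INR (fact r) * y ^ j * / (1 - y) ^ S (r + j))).
  { apply is_series_ext with (fun k => INR (fact (j + r)) / INR (fact r) * y ^ j
      * (Binomial.C (k + (r + j)) k * y ^ k)).
    2: now apply (@is_series_scal_l R_AbsRing R_NormedModule), is_series_negative_binomial.
    intros k; unfold Binomial.C.
    replace (k + (r + j) - k)%nat with (j + r)%nat by lia.
    replace (k + j + r - (k + j))%nat with r by lia.
    replace (k + (r + j))%nat with (k + j + r)%nat by lia.
    pose proof (ffact_shift k j) as H; apply (f_equal INR) in H.
    rewrite mult_INR in H; rewrite <- H, pow_add.
    pose proof (INR_fact_lt_0 (k + j)) as H1; rewrite <- H in H1.
    pose proof (INR_fact_lt_0 k) as H2; pose proof (INR_fact_lt_0 r) as H3.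
    pose proof (INR_fact_lt_0 (j + r)) as H4.
    eq_at R; field; repeat split; try lra; nra. }
  destruct j as [|j].
  - revert S0; apply is_series_ext; intros n; now rewrite Nat.add_0_r.
  - apply is_series_decr_n with (S j); [lia|].
    match goal with |- is_series ?f (plus ?l (opp ?s)) =>
      change (is_series f (l - s)); replace s with 0 end.
    + rewrite Rminus_0_r.
      revert S0; apply is_series_ext; intros n; now rewrite (Nat.add_comm n (S j)).
    + rewrite sum_n_ext_loc with (b := fun _ => 0).
      * rewrite sum_n_const, Rmult_0_r; reflexivity.
      * intros n Hn; simpl in Hn; rewrite ffact_lt by lia; eq_at R; simpl; ring.
Qed.

(** The previous series at [y = x / b], combined over [j] by [pow_stirling2]; the
    extra [1 / b^(r+1)] turns [y^j / (1-y)^(r+j+1)] into [x^j / (b-x)^(r+j+1)]. *)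
Lemma is_series_stirling r p x b : Rabs x < b ->
  is_series (fun n => Binomial.C (n + r) n * INR n ^ p * x ^ n * / b ^ (n + r + 1))
    (/ INR (fact r) * sum_n (fun j =>
       INR (stirling2 p j) * INR (fact (j + r)) * x ^ j * / (b - x) ^ (r + j + 1)) p).
Proof.
  intros Hx.
  assert (Hb : 0 < b) by (pose proof (Rabs_pos x); lra).
  assert (Hxb : 0 < b - x) by (pose proof (Rle_abs x); lra).
  assert (Hy : Rabs (x / b) < 1).
  { unfold Rdiv; rewrite Rabs_mult, Rabs_inv, (Rabs_pos_eq b) by lra.
    apply Rmult_lt_reg_r with b; [lra|].
    rewrite Rmult_assoc, Rinv_l by lra; lra. }
  pose proof (INR_fact_lt_0 r) as Hr.
  rewrite <- (sum_n_mult_l (K := R_Ring)).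
  apply is_series_ext with (fun n => sum_n (fun j =>
    / b ^ S r * INR (stirling2 p j) *
    (Binomial.C (n + r) n * INR (binomial.falling_factorial n j) * (x / b) ^ n)) p).
  { intros n.
    rewrite pow_stirling2, !(Rmult_comm (Binomial.C _ _)).
    rewrite 2!Rmult_assoc.
    rewrite <- (sum_n_mult_r (K := R_Ring)).
    apply sum_n_ext; intros j; change mult with Rmult.
    unfold Rdiv; rewrite Rpow_mult_distr, pow_inv.
    replace (n + r + 1)%nat with (n + S r)%nat by lia.
    rewrite pow_add.
    assert (b ^ n <> 0) by (apply pow_nonzero; lra).
    assert (b ^ S r <> 0) by (apply pow_nonzero; lra).
    eq_at R; field; auto. }
  apply (@is_series_sum_n R_AbsRing R_NormedModule); intros j.
  match goal with |- is_series _ ?l => replace l with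
    (/ b ^ S r * INR (stirling2 p j) * (INR (fact (j + r)) / INR (fact r) * (x / b) ^ j
      * / (1 - x / b) ^ S (r + j))) end.
  - now apply (@is_series_scal_l R_AbsRing R_NormedModule), is_series_negative_binomial_falling.
  - change mult with Rmult.
    replace (1 - x / b) with ((b - x) * / b) by (field; lra).
    unfold Rdiv; rewrite !Rpow_mult_distr, !pow_inv.
    replace (r + j + 1)%nat with (S (r + j))%nat by lia.
    replace (b ^ S (r + j)) with (b ^ S r * b ^ j) by (rewrite <- pow_add; f_equal; lia).
    assert (b ^ j <> 0) by (apply pow_nonzero; lra).
    assert (b ^ S r <> 0) by (apply pow_nonzero; lra).
    assert ((b - x) ^ S (r + j) <> 0) by (apply pow_nonzero; lra).
    eq_at R; field; repeat split; auto; lra.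
Qed.

(** * The Lerch transcendent *)

Lemma is_lim_seq_inv_shift a k : 0 < a -> is_lim_seq (fun m => / (INR m + a) ^ S k) 0.
Proof.
  intros Ha.
  apply is_lim_seq_le_le with (fun _ => 0) (fun m => / a ^ k * / (INR m + a)).
  - intros m; pose proof (pos_INR m) as Hm; split.
    + left; apply Rinv_0_lt_compat, pow_lt; lra.
    + rewrite <- Rinv_mult.
      apply Rinv_le_contravar.
      * apply Rmult_lt_0_compat; [apply pow_lt|]; lra.
      * simpl; rewrite Rmult_comm; apply Rmult_le_compat_l; [lra|].
        apply pow_incr; lra.
  - apply is_lim_seq_const.
  - replace (Finite 0) with (Rbar_mult (/ a ^ k) 0) by (simpl; f_equal; ring).
    apply is_lim_seq_scal_l.
    replace (Finite 0) with (Rbar_inv p_infty) by reflexivity.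
    apply is_lim_seq_inv; [|easy].
    apply (is_lim_seq_plus _ _ p_infty a); [apply is_lim_seq_INR|apply is_lim_seq_const|easy].
Qed.

(** Comparison with the telescoping [1/b - 1/(b+1)], where [b = m + a]; the ratio
    [1 + 1/b] of the two terms is at most [1 + 1/a]. *)
Lemma ex_series_inv_sqr_shift a : 0 < a -> ex_series (fun m => / (INR m + a) ^ 2).
Proof.
  intros Ha.
  pose (w := fun m => / (INR m + a) ^ 1).
  apply (@ex_series_le R_AbsRing R_CompleteNormedModule) with
    (fun m => (1 + / a) * (w m - w (S m))).
  - intros m; change norm with Rabs; unfold w; rewrite S_INR, !pow_1.
    pose proof (pos_INR m) as Hm; set (b := INR m + a).
    assert (Hb : a <= b) by (unfold b; lra).
    replace (INR m + 1 + a) with (b + 1) by (unfold b; ring).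
    rewrite Rabs_pos_eq by (left; apply Rinv_0_lt_compat, pow_lt; lra).
    replace (/ b ^ 2) with ((1 + / b) * (/ b - / (b + 1))) by (field; lra).
    apply Rmult_le_compat_r.
    + apply Rge_le, Rge_minus, Rle_ge, Rinv_le_contravar; lra.
    + apply Rplus_le_compat_l, Rinv_le_contravar; lra.
  - eexists; apply (@is_series_scal_l R_AbsRing R_NormedModule), is_series_telescope.
    now apply is_lim_seq_inv_shift.
Qed.

(** [LerchPhi] picks the limit of its partial sums by description; Abel summation
    with [v m = 1 / (m+a)^(k+1)] provides that limit. *)
Lemma is_series_LerchPhi k z a : 0 < a -> Cmod z <= 1 -> z <> RtoC 1 ->
  is_Cseries (fun m => z ^ m * RtoC (/ (INR m + a) ^ S k))%C (LerchPhi (INR (S k)) z a).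
Proof.
  intros Ha Hz Hz1.
  destruct (ex_series_Abel (fun m => / (INR m + a) ^ S k) z) as [l Hl]; auto.
  { intros m; pose proof (pos_INR m); apply Rinv_le_contravar.
    - apply pow_lt; lra.
    - apply pow_incr; rewrite S_INR; lra. }
  { now apply is_lim_seq_inv_shift. }
  replace (LerchPhi (INR (S k)) z a) with l; [exact Hl|].
  unfold LerchPhi, CSeries; symmetry.
  apply (@iota_filterlim_locally C_AbsRing C_CompleteNormedModule nat eventually _).
  revert Hl; apply filterlim_ext; intros n.
  apply sum_n_ext; intros m.
  rewrite Rpower_pow by (pose proof (pos_INR m); lra).
  unfold Cdiv; rewrite RtoC_inv; [reflexivity|].
  apply pow_nonzero; pose proof (pos_INR m); lra.
Qed.

Theorem proposition26 (a : R) (ha : 0 < a) (r p : nat) (x : R) (hx : Rabs x < a)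
    (z : C) (hz : Cmod z <= 1) (hz1 : z <> RtoC 1) :
  @is_series C_AbsRing C_NormedModule
    (fun n : nat =>
       (RtoC (Binomial.C (n + r) n * INR n ^ p)
        * LerchPhi (INR (n + r + 1)) z a * RtoC (x ^ n))%C)
    (RtoC (/ INR (fact r)) *
     @sum_n C_AbelianMonoid
       (fun j : nat =>
          (RtoC (INR (stirling2 p j) * Gamma (INR (j + r + 1)) * x ^ j)
           * LerchPhi (INR (r + j + 1)) z (a - x))%C) p)%C.
Proof.
  assert (Hax : 0 < a - x) by (pose proof (Rle_abs x); lra).
  pose (c := fun n => Binomial.C (n + r) n * INR n ^ p).
  pose (G := fun b => / INR (fact r) * sum_n (fun j =>
       INR (stirling2 p j) * INR (fact (j + r)) * x ^ j * / (b - x) ^ (r + j + 1)) p).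
  assert (Hc : forall n, 0 <= c n).
  { intros n; apply Rmult_le_pos; [|apply pow_le, pos_INR].
    apply Rmult_le_pos; [apply pos_INR|].
    left; apply Rinv_0_lt_compat, Rmult_lt_0_compat; apply INR_fact_lt_0. }
  apply series_exchange with
    (u := fun n m => (RtoC (c n * x ^ n) * (z ^ m * RtoC (/ (INR m + a) ^ (n + r + 1))))%C)
    (e := fun n => c n * Rabs x ^ n * / a ^ (n + r + 1))
    (w := fun m => a ^ 2 * / (INR m + a) ^ 2)
    (F := fun m => (z ^ m * RtoC (G (INR m + a)%R))%C).
  - eexists; apply is_series_stirling; now rewrite Rabs_Rabsolu.
  - apply (@ex_series_scal_l R_AbsRing R_NormedModule); now apply ex_series_inv_sqr_shift.
  - intros n m Hn.
    pose proof (pos_INR m) as Hm; set (b := INR m + a).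
    assert (Hb : a <= b) by (unfold b; lra).
    rewrite !Cmod_mult, !Cmod_R, Cmod_pow, Rabs_mult, <- RPow_abs.
    rewrite (Rabs_pos_eq (c n)) by apply Hc.
    rewrite (Rabs_pos_eq (/ _)) by (left; apply Rinv_0_lt_compat, pow_lt; lra).
    rewrite Rmult_assoc, (Rmult_assoc (c n * _)).
    rewrite <- (Rmult_assoc (c n)).
    apply Rmult_le_compat_l; [apply Rmult_le_pos; [apply Hc|apply pow_le, Rabs_pos]|].
    (* Two of the [n + r + 1] powers of [a / b] give [w]; since [n > 0] they
       exist, and the others are at most [1]. *)
    replace (n + r + 1)%nat with (2 + (n - 1 + r))%nat by lia.
    set (k := (n - 1 + r)%nat).
    assert (Hk : 0 < a ^ k <= b ^ k) by (split; [apply pow_lt|apply pow_incr]; lra).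
    assert (Ha2 : 0 < a ^ 2) by (apply pow_lt; lra).
    assert (Hb2 : 0 < b ^ 2) by (apply pow_lt; lra).
    rewrite !pow_add.
    replace (/ (a ^ 2 * a ^ k) * (a ^ 2 * / b ^ 2)) with (/ (b ^ 2 * a ^ k))
      by (field; lra).
    apply Rle_trans with (1 * / (b ^ 2 * b ^ k)).
    + apply Rmult_le_compat_r.
      * left; apply Rinv_0_lt_compat, Rmult_lt_0_compat; lra.
      * apply pow_le_1; split; [apply Cmod_ge_0|exact hz].
    + rewrite Rmult_1_l; apply Rinv_le_contravar.
      * apply Rmult_lt_0_compat; lra.
      * apply Rmult_le_compat_l; lra.
  - intros n.
    replace (n + r + 1)%nat with (S (n + r)) by lia.
    replace (RtoC (Binomial.C (n + r) n * INR n ^ p) * LerchPhi (INR (S (n + r))) z a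
      * RtoC (x ^ n))%C with (RtoC (c n * x ^ n) * LerchPhi (INR (S (n + r))) z a)%C
      by (unfold c; rewrite !RtoC_mult; ring).
    now apply (@is_series_scal_l C_AbsRing C_NormedModule), is_series_LerchPhi.
  - intros m.
    apply (@is_series_ext C_AbsRing C_NormedModule) with
      (fun n => z ^ m * RtoC (c n * x ^ n * / (INR m + a) ^ (n + r + 1)))%C.
    { intros n; rewrite (RtoC_mult (_ * _)).
      eq_at C; ring. }
    apply (@is_series_scal_l C_AbsRing C_NormedModule), is_series_RtoC, is_series_stirling.
    pose proof (pos_INR m); lra.
  - apply (@is_series_ext C_AbsRing C_NormedModule) with
      (fun m => RtoC (/ INR (fact r)) * Csum_n (fun j =>
         RtoC (INR (stirling2 p j) * Gamma (INR (j + r + 1)) * x ^ j)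
         * (z ^ m * RtoC (/ (INR m + (a - x)) ^ S (r + j)))) p)%C.
    + intros m; unfold G.
      rewrite RtoC_mult, RtoC_sum_n.
      eq_at C.
      rewrite Cmult_assoc, (Cmult_comm (z ^ m)), <- Cmult_assoc; f_equal.
      rewrite <- (sum_n_mult_l (K := C_Ring)).
      apply sum_n_ext; intros j; change mult with Cmult.
      rewrite Gamma_fact, (RtoC_mult (_ * _ ^ _)).
      replace (r + j + 1)%nat with (S (r + j)) by lia.
      replace (INR m + a - x) with (INR m + (a - x)) by ring.
      eq_at C; ring.
    + apply (@is_series_scal_l C_AbsRing C_NormedModule).
      apply (@is_series_sum_n C_AbsRing C_NormedModule); intros j.
      replace (r + j + 1)%nat with (S (r + j)) by lia.
      now apply (@is_series_scal_l C_AbsRing C_NormedModule), is_series_LerchPhi.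
Qed.
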